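(* Let $p,q\in\mathbb{C}^n$ be linearly independent, let $\alpha,\beta\in\{1,\dots,n\}$, and let $P,Q:\mathbf{U}(n)\to\mathbb{C}$ be the functions $$P(z)=\sum_{j=1}^n p_j z_{j\alpha},\qquad Q(z)=\sum_{k=1}^n q_k z_{k\beta}.$$ Let the rational function $f(z)=P(z)/Q(z)$ be defined on the open and dense subset $W_Q=\{z\in\mathbf{U}(n)\mid Q(z)\neq 0\}$ of $\mathbf{U}(n)$. Then the following is true. (a) The function $f$ is harmonic if and only if $\alpha=\beta$. (b) The function $f$ is proper biharmonic if and only if $\alpha\neq\beta$. The corresponding statements hold for the function induced by $f$ on $\mathbf{SU}(n)$, i.e. for the restriction of $f$ to $W_Q\cap\mathbf{SU}(n)$.
   Context: $\mathbf{U}(n)=\{z\in\mathbf{GL}_n(\mathbb{C})\mid zz^*=I_n\}$ is the unitary group and $\mathbf{SU}(n)=\{z\in\mathbf{U}(n)\mid\det z=1\}$. For $1\le j,\alpha\le n$, $z_{j\alpha}$ denotes the $(j,\alpha)$-entry (row $j$, column $\alpha$) of the matrix $z$. Both groups carry the left-invariant (in fact biinvariant) Riemannian metric induced by the scalar product $g(Z,W)=\mathrm{Re}\,\mathrm{trace}(ZW^* )$ on the Lie algebra. For a complex-valued function $f$ on an open subset of a Riemannian manifold, $\tau(f)=\mathrm{div}(\nabla f)$ is the Laplace-Beltrami operator (extended complex-linearly) and $\tau^2(f)=\tau(\tau(f))$. The function $f$ is harmonic if $\tau(f)=0$; it is proper biharmonic if $\tau^2(f)=0$ and $\tau(f)$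 does not vanish identically. On $\mathbf{U}(n)$ the function $f$ is invariant under the action $(e^{i\theta},z)\mapsto e^{i\theta}z$ of the circle group. *)

(* Defs.v *)
From HB Require Import structures.
From mathcomp Require Import all_boot all_order all_algebra.
From mathcomp Require Import spectral.
From mathcomp Require Import all_classical all_reals all_analysis.
From mathcomp Require Export complex.

Set Implicit Arguments.
Unset Strict Implicit.
Unset Printing Implicit Defensive.

Import Order.TTheory GRing.Theory Num.Theory.
Import numFieldNormedType.Exports.

Local Open Scope classical_set_scope.
Local Open Scope ring_scope.
Local Open Scope complex_scope.
Local Open Scope sesquilinear_scope.

Section MatrixGroups.
Variables (R : realType) (n : nat).
Local Notation M := 'M[R[i]]_n.

Definition U_group : set M := [set z | z \is unitarymx].
Definition SU_group : set M := [set z | z \is unitarymx /\ \det z = 1].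

Definition u_alg : set M := [set X | X ^t* = - X].
Definition su_alg : set M := [set X | X ^t* = - X /\ \tr X = 0].

(* The type ascription selects the topology that a numFieldType carries; it
   is the usual topology of the complex numbers. *)
Definition expmx (X : M) : M :=
  limn (series (fun k => (k`!%:R)^-1 *: X ^+ k) : nat -> 'M[R[i] : numFieldType]_n).

Definition metric (Z W : M) : R := complex.Re (\tr (Z *m W ^t*)).

Definition bracket (X Y : M) : M := X *m Y - Y *m X.

(* X(f)(z) for the left-invariant vector field z |-> z X.  If z lies in a
   matrix group and X in its Lie algebra, then only the values of f on that
   group are involved. *)
Definition linv_deriv (X : M) (f : M -> R) (z : M) : R :=
  derive1 (fun t : R => f (z *m expmx (t%:C *: X))) 0.

(* A real subspace g of M stands for the Lie algebra of a matrix group G.  A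
   vector field on G is represented in the left trivialization, as a function
   V with values in g whose tangent vector at z is z V(z); the left-invariant
   metric at z is then [metric] on g. *)

Definition orthonormal_family (g : set M) (e : seq M) : Prop :=
  (forall X, X \in e -> g X) /\
  (forall j k, (j < size e)%N -> (k < size e)%N ->
     metric e`_j e`_k = (j == k)%:R).

Definition orthonormal_basis (g : set M) (e : seq M) : Prop :=
  orthonormal_family g e /\
  (forall X, g X ->
     exists c : nat -> R, X = \sum_(k < size e) (c k)%:C *: e`_k).

(* A chosen basis; see [frameP]. *)
Definition frame (g : set M) : seq M := xget [::] (orthonormal_basis g).

(* The Riesz representative of the differential of f at z. *)
Definition gradient (g : set M) (f : M -> R) (z : M) : M :=
  xget 0 [set V | g V /\ forall X, g X -> metric V X = linv_deriv X f z].

(* The scalar product of nabla_X Y with Z for left-invariant X, Y, Z, where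
   nabla is the Levi-Civita connection: the Koszul formula, in which the
   derivatives of the (constant) scalar products vanish. *)
Definition koszul (X Y Z : M) : R :=
  2^-1 * (metric (bracket X Y) Z - metric (bracket Y Z) X
          + metric (bracket Z X) Y).

(* The scalar product of nabla_X V with Z at z, for left-invariant X and Z and
   an arbitrary vector field V: expand V in a left-invariant frame. *)
Definition covariant_deriv (X : M) (V : M -> M) (Z z : M) : R :=
  linv_deriv X (fun w => metric (V w) Z) z + koszul X (V z) Z.

(* The trace of X |-> nabla_X V. *)
Definition divergence (g : set M) (V : M -> M) (z : M) : R :=
  \sum_(X <- frame g) covariant_deriv X V X z.

Definition laplacian_real (g : set M) (f : M -> R) : M -> R :=
  divergence g (gradient g f).

Definition laplacian (g : set M) (f : M -> R[i]) (z : M) : R[i] :=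
  laplacian_real g (fun w => complex.Re (f w)) z
  +i* laplacian_real g (fun w => complex.Im (f w)) z.

(* In the next two definitions W is meant to be an open subset of a matrix
   group with Lie algebra g, and f a function that is smooth on W; its values
   off W are irrelevant. *)
Definition harmonic_on (g : set M) (W : set M) (f : M -> R[i]) : Prop :=
  forall z, W z -> laplacian g f z = 0.

Definition proper_biharmonic_on (g : set M) (W : set M) (f : M -> R[i]) : Prop :=
  (forall z, W z -> laplacian g (laplacian g f) z = 0) /\
  (exists2 z, W z & laplacian g f z != 0).

Lemma Re_add (x y : R[i]) : complex.Re (x + y) = complex.Re x + complex.Re y.
Proof. by case: x y => [a b] [c d]. Qed.

Lemma Re_sum (I : finType) (F : I -> R[i]) :
  complex.Re (\sum_k F k) = \sum_k complex.Re (F k).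
Proof. exact: (big_morph _ Re_add). Qed.

Lemma metricE X Y : metric X Y = \sum_j \sum_k
  (complex.Re (X j k) * complex.Re (Y j k)
   + complex.Im (X j k) * complex.Im (Y j k)).
Proof.
rewrite /metric /mxtrace Re_sum.
apply: eq_bigr => j _; rewrite mxE Re_sum.
apply: eq_bigr => k _; rewrite !mxE.
by case: (X j k) => a b; case: (Y j k) => c d /=; rewrite mulrN opprK.
Qed.

Lemma metricC X Y : metric X Y = metric Y X.
Proof.
rewrite !metricE; apply: eq_bigr => j _; apply: eq_bigr => k _.
by rewrite mulrC [X in _ + X]mulrC.
Qed.

Lemma metricDl X Y Z : metric (X + Y) Z = metric X Z + metric Y Z.
Proof. by rewrite /metric mulmxDl mxtraceD Re_add. Qed.

Lemma metricZl a X Z : metric (a%:C *: X) Z = a * metric X Z.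
Proof.
rewrite /metric -scalemxAl mxtraceZ.
by case: (\tr _) => b c /=; rewrite mul0r subr0.
Qed.

Lemma metric_suml (I : finType) (F : I -> M) Z :
  metric (\sum_k F k) Z = \sum_k metric (F k) Z.
Proof. by rewrite /metric mulmx_suml (raddf_sum (@mxtrace _ n)) Re_sum. Qed.

Lemma metric_gt0 X : X != 0 -> 0 < metric X X.
Proof.
move=> X0; rewrite metricE.
have sq_ge0 j k : 0 <= complex.Re (X j k) * complex.Re (X j k)
   + complex.Im (X j k) * complex.Im (X j k).
  by rewrite -!expr2 addr_ge0 ?sqr_ge0.
rewrite lt_neqAle sumr_ge0 ?andbT; last by move=> j _; exact: sumr_ge0.
apply: contra X0 => /eqP /esym s0; apply/eqP/matrixP => j k; rewrite mxE.
have := s0; move/eqP; rewrite psumr_eq0; last by move=> ? _; exact: sumr_ge0.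
move=> /allP /(_ j); rewrite mem_index_enum => /(_ isT) /=.
rewrite psumr_eq0 // => /allP /(_ k); rewrite mem_index_enum => /(_ isT) /=.
rewrite -!expr2 paddr_eq0 ?sqr_ge0 // !sqrf_eq0.
by case: (X j k) => a b /= /andP[/eqP -> /eqP ->].
Qed.

Lemma orthonormal_size (g : set M) (e : seq M) :
  orthonormal_family g e -> (size e <= n * n + n * n)%N.
Proof.
move=> [_ on].
pose v (X : M) := row_mx (mxvec (map_mx (@complex.Re R) X))
                         (mxvec (map_mx (@complex.Im R) X)).
have vE X Y : metric X Y = (v X *m (v Y)^T) 0 0.
  rewrite metricE /v tr_row_mx mul_row_col !mxE.
  rewrite pair_bigA /= -big_split /= (reindex _ (curry_mxvec_bij _ _)) /=.
  apply: eq_bigr => -[j k] _ /=.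
  by rewrite ![in RHS]mxE !mxvecE !mxE.
pose A := \matrix_(j < size e) v e`_j.
apply: (@mulmx1_min _ _ _ A A^T); apply/matrixP => j k.
have := on j k (ltn_ord j) (ltn_ord k); rewrite vE !mxE => <-.
by apply: eq_bigr => l _; rewrite !mxE.
Qed.

Lemma frameP (g : set M) : g 0 ->
  (forall a X Y, g X -> g Y -> g (a%:C *: X + Y)) ->
  orthonormal_basis g (frame g).
Proof.
move=> g0 gD.
suff : exists e, orthonormal_basis g e by move=> [e ?]; exact: (xgetI _ (x := e)).
pose P k := `[< exists e, size e = k /\ orthonormal_family g e >].
have exP : exists k, P k by exists 0%N; apply/asboolP; exists [::].
have ubP k : P k -> (k <= n * n + n * n)%N.
  by move=> /asboolP [e [<- /orthonormal_size]].
case: (ex_maxnP exP ubP) => m /asboolP [e [em one]] maxm; exists e; split=> //.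
move=> X gX; exists (fun k => metric X e`_k); apply/eqP; rewrite -subr_eq0.
set S := \sum_(k < _) _; apply/negP => /negP D0.
have gS a : g (\sum_(k < size e) (a k)%:C *: e`_k).
  apply: (big_ind g) => //.
    by move=> Y Z gY gZ; have := gD 1 Y Z gY gZ; rewrite scale1r.
  move=> k _; rewrite -[X in g X]addr0; apply: gD => //.
  by apply: one.1; exact: mem_nth.
have gXS : g (X - S).
  have -> : X - S = (-1)%:C *: S + X by rewrite rmorphN scaleN1r addrC.
  by apply: gD => //; exact: gS.
have oXS k : (k < size e)%N -> metric (X - S) e`_k = 0.
  move=> ke; rewrite metricDl -scaleN1r -[-1](rmorphN1 (real_complex R)) metricZl.
  rewrite metric_suml (bigD1 (Ordinal ke)) //= metricZl one.2 // eqxx mulr1.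
  rewrite big1 ?addr0 ?mulN1r ?subrr // => j jk.
  by rewrite metricZl one.2 // (negPf (_ : val j != k)) ?mulr0.
have lpos := metric_gt0 D0.
pose l := Num.sqrt (metric (X - S) (X - S)).
pose Y := (l^-1)%:C *: (X - S).
have : P m.+1; last by move=> /maxm; rewrite ltnn.
apply/asboolP; exists (rcons e Y); rewrite size_rcons em; split=> //.
have YY : metric Y Y = 1.
  rewrite metricZl metricC metricZl mulrA -invfM -expr2 sqr_sqrtr ?ltW //.
  by rewrite mulVf // gt_eqF.
have Ye k : (k < size e)%N -> metric Y e`_k = 0.
  by move=> ke; rewrite metricZl oXS ?mulr0.
split=> [Z|j k]; rewrite ?mem_rcons ?inE ?size_rcons.
  move=> /orP[/eqP ->|]; last exact: one.1.
  by rewrite -[Y]addr0; apply: gD.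
rewrite !ltnS !nth_rcons; case: (ltngtP j (size e)) => // js _;
  case: (ltngtP k (size e)) => // ks _.
- exact: one.2.
- by rewrite metricC Ye // ks (ltn_eqF js).
- by rewrite Ye // js (gtn_eqF ks).
- by rewrite YY js ks eqxx.
Qed.

Lemma adjoint_linear a X Y :
  (a%:C *: X + Y) ^t* = a%:C *: X ^t* + Y ^t* :> M.
Proof.
apply/matrixP => j k; rewrite !mxE rmorphD rmorphM; congr (_ * _ + _).
by rewrite -[LHS]/(a -i* 0) oppr0.
Qed.

Lemma u_frameP : orthonormal_basis u_alg (frame u_alg).
Proof.
apply: frameP => [|a X Y]; rewrite /u_alg /=.
  by apply/matrixP => j k; rewrite !mxE rmorph0 oppr0.
by move=> Xs Ys; rewrite adjoint_linear Xs Ys scalerN opprD.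
Qed.

Lemma su_frameP : orthonormal_basis su_alg (frame su_alg).
Proof.
apply: frameP => [|a X Y]; rewrite /su_alg /=.
  by rewrite mxtrace0; split=> //; apply/matrixP => j k; rewrite !mxE rmorph0 oppr0.
move=> [Xs Xt] [Ys Yt]; split.
  by rewrite adjoint_linear Xs Ys scalerN opprD.
by rewrite mxtraceD mxtraceZ Xt Yt mulr0 addr0.
Qed.

End MatrixGroups.

(* Main.v *)
Require Import Defs.
From HB Require Import structures.
From mathcomp Require Import all_boot all_order all_algebra.
From mathcomp Require Import fingroup perm spectral ring lra.
From mathcomp Require Import all_classical all_reals all_analysis.
From mathcomp Require Import complex.

(** On the open set where Q does not vanish, f = P/Q is a rational function of
    an arbitrary complex matrix z.  The Laplacian of such a function is the sum
    of the second derivatives X(X(f)) over an orthonormal basis X of the Lie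
    algebra: the Levi-Civita correction drops out, because the metric is
    biinvariant ([koszul_skew], [laplacianE]).  So both Laplacians of f can be
    computed on the whole set Q <> 0, and unitary matrices matter only at the
    very end, where a point with tau(f) <> 0 has to be exhibited.

    Let [colform a i z] stand for the linear form a.z_i in the column z_i of z.
    The Casimir identity [u_casimir], [su_casimir] says that the sum of
    tr(XA) X over an orthonormal basis is e tr(A) I - A, with e = 0 for u(n)
    and e = 1/n for su(n).  It yields
      tau(a.z_i) = (e - n) a.z_i,
      sum_X X(a.z_i) X(b.z_j) = e (a.z_i)(b.z_j) - (a.z_j)(b.z_i):
    up to the multiples of e, the gradients pair by exchanging the columns.

    Let P' = p.z_beta and Q' = q.z_alpha be the forms with the two columns
    exchanged, and F = P'Q'/Q^2.  Both f = PQ/Q^2 and F have degree zero, which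
    makes all terms in e and n cancel, and [has_laplacian_ratio] specializes to
      tau(f) = 2 (F - f) = tau(F).
    Hence tau^2(f) = 2 (tau(F) - tau(f)) = 0 in all cases.  If alpha = beta,
    then F = f and f is harmonic.  If alpha and beta differ, orthonormalizing
    the conjugates of q and p, in this order, gives the columns beta and alpha
    of a matrix of SU(n) at which Q <> 0, Q' = 0 and P <> 0, so that F = 0 and
    f <> 0 there ([special_unitary_witness]).  The same point serves for U(n)
    and for SU(n). *)

Set Implicit Arguments.
Unset Strict Implicit.
Unset Printing Implicit Defensive.

Import Order.TTheory GRing.Theory Num.Theory.
Import numFieldNormedType.Exports.
Local Open Scope classical_set_scope.
Local Open Scope ring_scope.
Local Open Scope complex_scope.
Local Open Scope sesquilinear_scope.
Import Normc.

(** * Power series with coefficients of exponential type *)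

Section ExponentialSeries.
Variable R : realType.
Implicit Types (c : R^nat) (B r K : R).

(** The coefficients of the entries of t |-> exp(tX) satisfy this bound.  Unlike
    convergence of the power series, it passes to the series of derivatives by
    a computation with coefficients. *)
Definition exp_bounded B r c := forall k, `|c k| <= B * r ^+ k / k`!%:R.

Lemma exp_bounded_diffs B r c :
  exp_bounded B r c -> exp_bounded (B * r) r (pseries_diffs c).
Proof.
move=> cB k; rewrite /pseries_diffs normrM normr_nat.
apply: le_trans (ler_wpM2l (ler0n _ _) (cB k.+1)) _.
rewrite factS natrM invfM exprS !mulrA.
rewrite [leLHS](_ : _ = k.+1%:R / k.+1%:R * (B * r * r ^+ k / k`!%:R)); last by ring.
by rewrite divff ?pnatr_eq0 // mul1r.
Qed.

Lemma exp_bounded_cvg B r c K : 0 <= B -> 0 <= r ->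
  exp_bounded B r c -> cvgn (pseries c K).
Proof.
move=> B0 r0 cB; apply: normed_cvg.
apply: (@series_le_cvg _ _ (fun k => B * exp_coeff (r * `|K|) k)) => [k|k|k|].
- exact: normr_ge0.
- by rewrite mulr_ge0 // /exp_coeff /= divr_ge0 ?exprn_ge0 ?mulr_ge0 ?ler0n.
- rewrite /= normrM normrX; apply: le_trans (ler_wpM2r _ (cB k)) _.
    by rewrite exprn_ge0.
  by rewrite /exp_coeff /= exprMn !mulrA mulrAC.
- exact: is_cvg_seriesZ (is_cvg_series_exp_coeff _).
Qed.

Lemma pseries_at0 c : limn (pseries c 0) = c 0%N.
Proof.
apply: cvg_lim => //; rewrite -(cvg_shiftS (pseries c 0)) /=.
rewrite [X in X @ _ --> _](_ : _ = fun=> c 0%N); first exact: cvg_cst.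
apply/funext => n; rewrite /pseries /series /= big_nat_recl //= expr0 mulr1.
by rewrite big1 ?addr0 // => k _; rewrite exprS mul0r mulr0.
Qed.

Lemma exp_bounded_derive0 B r c : 0 <= B -> 0 <= r -> exp_bounded B r c ->
  is_derive (0 : R) (1 : R) (fun t => limn (pseries c t)) (c 1%N).
Proof.
move=> B0 r0 cB; have cB' := exp_bounded_diffs cB.
have Br0 : 0 <= B * r by rewrite mulr_ge0.
have Brr0 : 0 <= B * r * r by rewrite mulr_ge0.
have := @pseries_snd_diffs R c 1 0 (exp_bounded_cvg B0 r0 cB)
  (exp_bounded_cvg Br0 r0 cB')
  (exp_bounded_cvg Brr0 r0 (exp_bounded_diffs cB')).
rewrite pseries_at0 /pseries_diffs mul1r; apply.
by rewrite normr0 normr1 ltr01.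
Qed.

End ExponentialSeries.

(** * The matrix exponential near the origin *)

Section MatrixExponential.
Variables (R : realType) (n : nat).
Local Notation M := 'M[R[i]]_n.

Lemma ImD (x y : R[i]) : complex.Im (x + y) = complex.Im x + complex.Im y.
Proof. by case: x y => [? ?] [? ?]. Qed.

Lemma cvgn_complex (u : nat -> R[i]) (a b : R) :
  (fun k => complex.Re (u k)) @ \oo --> a ->
  (fun k => complex.Im (u k)) @ \oo --> b ->
  (u : nat -> (R[i] : numFieldType)) @ \oo --> (a +i* b : (R[i] : numFieldType)).
Proof.
move=> ua ub; apply/cvgrPdist_lt => e; case: e => e1 e2.
rewrite ltcE /= => /andP[/eqP -> e0].
have e20 : 0 < e1 / 2 by rewrite divr_gt0.
move/cvgrPdist_lt: ua => /(_ _ e20) ua.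
move/cvgrPdist_lt: ub => /(_ _ e20) ub.
near=> k; have ak : `|a - complex.Re (u k)| < e1 / 2 by near: k.
have bk : `|b - complex.Im (u k)| < e1 / 2 by near: k.
case: (u k) ak bk => x y /= ax bY.
rewrite normc_def ltcR /=.
apply: (@le_lt_trans _ _ (`|a - x| + `|b - y|)); last by lra.
rewrite -[leRHS]ger0_norm ?addr_ge0 // -[leRHS]sqrtr_sqr ler_sqrt ?sqr_ge0 //.
rewrite [leRHS]sqrrD !real_normK ?num_real // addrAC.
by rewrite lerDl mulrn_wge0 // mulr_ge0.
Unshelve. all: by end_near. Qed.

Lemma cvgn_mx (m p : nat) (T : numFieldType) (u : nat -> 'M[T]_(m, p)) (A : 'M[T]_(m, p)) :
  (forall i j, (fun k => u k i j) @ \oo --> A i j) -> u @ \oo --> A.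
Proof.
move=> uA; apply/cvg_mx_entourageP => E entE.
have H i j : \forall k \near \oo, (A i j, u k i j) \in E.
  have /cvg_app_entourageP/(_ E entE) H := uA i j.
  by apply: filterS H => k /= ?; rewrite inE.
have : \forall k \near \oo, forall ij, (A ij.1 ij.2, u k ij.1 ij.2) \in E.
  by apply: filter_forall => -[i j]; exact: H.
by rewrite near_simpl; apply: filterS => k Hk i j; exact: (Hk (i, j)).
Qed.

Lemma normc_sum (I : Type) (s : seq I) (F : I -> R[i]) :
  normc (\sum_(k <- s) F k) <= \sum_(k <- s) normc (F k).
Proof.
elim/big_ind2: _ => [|x a y b xa yb|//]; first by rewrite normc0.
exact: le_trans (le_normcD _ _) (lerD xa yb).
Qed.

Lemma normc_ge0 (x : R[i]) : 0 <= normc x.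
Proof. by case: x => a b; exact: sqrtr_ge0. Qed.

Definition entry_norm (X : M) := \sum_a \sum_b normc (X a b).

Lemma entry_norm_ge0 X : 0 <= entry_norm X.
Proof. by do 2 (apply: sumr_ge0 => ? _); exact: normc_ge0. Qed.

Lemma normc_powmx (X : M) k i j : normc ((X ^+ k) i j) <= entry_norm X ^+ k.
Proof.
elim: k i j => [|k IH] i j.
  rewrite !expr0 mxE; case: (_ == _); first by rewrite normc1.
  by rewrite normc0.
rewrite !exprS -mulmxE mxE; apply: le_trans (normc_sum _ _) _.
set r := entry_norm X in IH *.
apply: (@le_trans _ _ (\sum_l normc (X i l) * r ^+ k)).
  by apply: ler_sum => l _; rewrite normcM ler_wpM2l // normc_ge0.
rewrite -mulr_suml ler_wpM2r //.
  by rewrite exprn_ge0 // entry_norm_ge0.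
rewrite /r /entry_norm [leRHS](bigD1 i) //= lerDl; do 2 (apply: sumr_ge0 => ? _); exact: normc_ge0.
Qed.

Lemma abs_Re_normc (x : R[i]) : `|complex.Re x| <= normc x.
Proof.
by case: x => a b /=; rewrite -sqrtr_sqr ler_sqrt ?addr_ge0 ?sqr_ge0 // lerDl sqr_ge0.
Qed.

Lemma abs_Im_normc (x : R[i]) : `|complex.Im x| <= normc x.
Proof.
by case: x => a b /=; rewrite -sqrtr_sqr ler_sqrt ?addr_ge0 ?sqr_ge0 // lerDr sqr_ge0.
Qed.

Definition re_coeff (X : M) i j : R^nat :=
  fun k => complex.Re ((X ^+ k) i j) / k`!%:R.
Definition im_coeff (X : M) i j : R^nat :=
  fun k => complex.Im ((X ^+ k) i j) / k`!%:R.

Lemma re_coeff_bounded X i j : exp_bounded 1 (entry_norm X) (re_coeff X i j).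
Proof.
move=> k; rewrite /re_coeff normrM mul1r [`|_^-1|]ger0_norm ?invr_ge0 ?ler0n //.
rewrite ler_wpM2r ?invr_ge0 ?ler0n //.
exact: le_trans (abs_Re_normc _) (normc_powmx _ _ _ _).
Qed.

Lemma im_coeff_bounded X i j : exp_bounded 1 (entry_norm X) (im_coeff X i j).
Proof.
move=> k; rewrite /im_coeff normrM mul1r [`|_^-1|]ger0_norm ?invr_ge0 ?ler0n //.
rewrite ler_wpM2r ?invr_ge0 ?ler0n //.
exact: le_trans (abs_Im_normc _) (normc_powmx _ _ _ _).
Qed.

Lemma expmx_term (X : M) (t : R) i j k :
  ((k`!%:R)^-1 *: (t%:C *: X) ^+ k) i j =
  (re_coeff X i j k * t ^+ k) +i* (im_coeff X i j k * t ^+ k).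
Proof.
have -> : (t%:C *: X) ^+ k = (t ^+ k)%:C *: X ^+ k.
  elim: k => [|k IH]; first by rewrite !expr0 scale1r.
  by rewrite !exprS IH -!mulmxE -scalemxAl -scalemxAr scalerA rmorphM.
have -> : (k`!%:R : R[i])^-1 = ((k`!%:R : R)^-1)%:C by rewrite fmorphV rmorph_nat.
rewrite !mxE mulrA -rmorphM /re_coeff /im_coeff; case: (_ i j) => a b /=.
by simpc; congr (_ +i* _); ring.
Qed.

(** The limit in the definition of [expmx] is taken in the space of complex
    matrices.  Splitting every entry into real and imaginary parts replaces it
    by real power series in t, which can be differentiated term by term. *)
Lemma expmxE (X : M) (t : R) i j :
  expmx (t%:C *: X) i j = limn (pseries (re_coeff X i j) t)
                       +i* limn (pseries (im_coeff X i j) t).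
Proof.
pose L := \matrix_(i, j) (limn (pseries (re_coeff X i j) t)
                       +i* limn (pseries (im_coeff X i j) t)) : M.
suff -> : expmx (t%:C *: X) = L by rewrite mxE.
rewrite /expmx.
apply: (@cvg_lim ('M[R[i] : numFieldType]_n : normedModType (R[i] : numFieldType))).
  exact: norm_hausdorff.
apply: cvgn_mx => a b; rewrite mxE; apply: cvgn_complex.
- rewrite [X in X @ _ --> _](_ : _ = pseries (re_coeff X a b) t).
    exact: exp_bounded_cvg ler01 (entry_norm_ge0 X) (re_coeff_bounded X a b).
  apply/funext => N; rewrite /series /= summxE.
  by rewrite (big_morph _ (@Re_add R) (erefl _)); apply: eq_bigr => k _; rewrite expmx_term.
- rewrite [X in X @ _ --> _](_ : _ = pseries (im_coeff X a b) t).
    exact: exp_bounded_cvg ler01 (entry_norm_ge0 X) (im_coeff_bounded X a b).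
  apply/funext => N; rewrite /series /= summxE.
  by rewrite (big_morph _ ImD (erefl _)); apply: eq_bigr => k _; rewrite expmx_term.
Qed.

Lemma expmx0 (X : M) : expmx ((0 : R)%:C *: X) = 1%:M.
Proof.
apply/matrixP => i j; rewrite expmxE !pseries_at0 /re_coeff /im_coeff expr0 fact0.
by rewrite !mxE; case: (_ == _); rewrite /= !divr1.
Qed.
End MatrixExponential.

(** * Derivatives at the origin of complex-valued curves *)

Section ComplexCurves.
Variable R : realType.
Implicit Types (u v : R -> R[i]) (d e : R[i]).

(** The derivative at 0 of a curve in the complex plane, by real and imaginary
    parts, which are the functions that [laplacian] differentiates. *)
Definition cderive u d :=
  is_derive (0 : R) (1 : R) (fun t => complex.Re (u t)) (complex.Re d) /\
  is_derive (0 : R) (1 : R) (fun t => complex.Im (u t)) (complex.Im d).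

Lemma ReM (x y : R[i]) :
  complex.Re (x * y) = complex.Re x * complex.Re y - complex.Im x * complex.Im y.
Proof. by case: x y => [? ?] [? ?]. Qed.

Lemma ImM (x y : R[i]) :
  complex.Im (x * y) = complex.Re x * complex.Im y + complex.Im x * complex.Re y.
Proof. by case: x y => [? ?] [? ?]. Qed.

Lemma cderive_near u v d :
  (\forall t \near (0 : R), u t = v t) -> cderive u d -> cderive v d.
Proof.
move=> uv [ru iu]; split; [apply: near_eq_is_derive ru|apply: near_eq_is_derive iu];
  by apply: filterS uv => t ->.
Qed.

Lemma cderive_cst d : cderive (fun=> d) 0.
Proof. by split; exact: is_derive_cst. Qed.

Lemma cderiveD u v d e :
  cderive u d -> cderive v e -> cderive (fun t => u t + v t) (d + e).
Proof.
move=> [ru iu] [rv iv]; split.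
  rewrite Re_add; under eq_fun do rewrite Re_add; exact: is_deriveD.
rewrite ImD; under eq_fun do rewrite ImD; exact: is_deriveD.
Qed.

Lemma cderiveM u v d e :
  cderive u d -> cderive v e ->
  cderive (fun t => u t * v t) (d * v 0 + u 0 * e).
Proof.
move=> [ru iu] [rv iv]; split.
  under eq_fun do rewrite ReM.
  apply: is_derive_eq (is_deriveB (is_deriveM ru rv) (is_deriveM iu iv)) _.
  by rewrite Re_add !ReM /GRing.scale /=; ring.
under eq_fun do rewrite ImM.
apply: is_derive_eq (is_deriveD (is_deriveM ru iv) (is_deriveM iu rv)) _.
by rewrite ImD !ImM /GRing.scale /=; ring.
Qed.

Lemma cderive_sum (I : Type) (s : seq I) (F : I -> R -> R[i]) (G : I -> R[i]) :
  (forall k, cderive (F k) (G k)) ->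
  cderive (fun t => \sum_(k <- s) F k t) (\sum_(k <- s) G k).
Proof.
move=> FG; elim: s => [|k s IH].
  by rewrite big_nil; under eq_fun do rewrite big_nil; exact: cderive_cst.
rewrite big_cons; under eq_fun do rewrite big_cons.
exact: cderiveD.
Qed.

Lemma sqr_complex_eq0 (x : R[i]) :
  ((complex.Re x) ^+ 2 + (complex.Im x) ^+ 2 == 0) = (x == 0).
Proof.
by case: x => a b; rewrite paddr_eq0 ?sqr_ge0 //= !sqrf_eq0 eq_complex.
Qed.

Lemma is_derive_sqr_complex u d : cderive u d ->
  is_derive (0 : R) (1 : R)
    (fun t => (complex.Re (u t)) ^+ 2 + (complex.Im (u t)) ^+ 2)
    (2 * (complex.Re (u 0) * complex.Re d + complex.Im (u 0) * complex.Im d)).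
Proof.
move=> [ru iu]; apply: is_derive_eq (is_deriveD (is_deriveX 2 ru) (is_deriveX 2 iu)) _.
by rewrite /GRing.scale /= !expr1; ring.
Qed.

Lemma cderive_neq0 u d : cderive u d -> u 0 != 0 ->
  \forall t \near (0 : R), u t != 0.
Proof.
move=> /is_derive_sqr_complex [du _] u0.
have /differentiable_continuous ct := (derivable1_diffP _ _).1 du.
have n0 : (complex.Re (u 0)) ^+ 2 + (complex.Im (u 0)) ^+ 2 != 0.
  by rewrite sqr_complex_eq0.
have H : \forall t \near (0 : R),
    complex.Re (u t) ^+ 2 + complex.Im (u t) ^+ 2 != 0.
  exact: cvgr_neq0 _ ct n0.
by apply: filterS H => t; rewrite sqr_complex_eq0.
Qed.

Lemma cderiveV u d : cderive u d -> u 0 != 0 ->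
  cderive (fun t => (u t)^-1) (- d / (u 0) ^+ 2).
Proof.
move=> ud u0; have sq := is_derive_sqr_complex ud.
have n0 : (complex.Re (u 0)) ^+ 2 + (complex.Im (u 0)) ^+ 2 != 0.
  by rewrite sqr_complex_eq0.
have sqV := @is_deriveV _
  (fun t => complex.Re (u t) ^+ 2 + complex.Im (u t) ^+ 2) 0 _ _ n0 sq.
have ReV (x : R[i]) : complex.Re x^-1 =
  complex.Re x * ((complex.Re x) ^+ 2 + (complex.Im x) ^+ 2)^-1 by case: x.
have ImV (x : R[i]) : complex.Im x^-1 =
  - complex.Im x * ((complex.Re x) ^+ 2 + (complex.Im x) ^+ 2)^-1.
  by case: x => a b /=; rewrite mulNr.
have n2 (a b : R) : a ^+ 2 + b ^+ 2 != 0 ->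
    (a * a - b * b) ^+ 2 + (a * b + b * a) ^+ 2 != 0.
  rewrite (_ : (_ - _) ^+ 2 + _ = (a ^+ 2 + b ^+ 2) ^+ 2); last by ring.
  by rewrite sqrf_eq0.
case: ud => ru iu; split.
  under eq_fun do rewrite ReV.
  apply: is_derive_eq (is_deriveM ru sqV) _.
  case: (u 0) n0 d ru iu {sq sqV u0} => a b /= n0 [c e] _ _.
  by rewrite /GRing.scale /=; field; rewrite n2.
under eq_fun do rewrite ImV.
apply: is_derive_eq (is_deriveM (is_deriveN iu) sqV) _.
rewrite -[(- _) 0]/(- complex.Im (u 0)).
case: (u 0) n0 d ru iu {sq sqV u0} => a b /= n0 [c e] _ _.
by rewrite /GRing.scale /=; field; rewrite n2.
Qed.

End ComplexCurves.

(** * The Laplacian as a sum of second derivatives *)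

Section Laplacian.
Variables (R : realType) (n : nat).
Local Notation M := 'M[R[i]]_n.
Implicit Types (X Y Z z w : M) (g O : set M).

Definition curve z X (t : R) : M := z *m expmx (t%:C *: X).

Lemma curve0 z X : curve z X 0 = z.
Proof. by rewrite /curve expmx0 mulmx1. Qed.

Definition real_subspace g :=
  g 0 /\ forall (a : R) X Y, g X -> g Y -> g (a%:C *: X + Y).

Lemma real_subspace_sum g (e : seq M) (c : nat -> R) : real_subspace g ->
  (forall X, X \in e -> g X) -> g (\sum_(k < size e) (c k)%:C *: e`_k).
Proof.
move=> [g0 gD] eg; apply: (big_ind g) => // [X Y gX gY|k _].
  by have := gD 1 X Y gX gY; rewrite scale1r.
by rewrite -[X in g X]addr0; apply: gD => //; apply: eg; exact: mem_nth.
Qed.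

Lemma real_linear_sum (V : lmodType R) (D : M -> V) (e : seq M) (c : nat -> R) :
  (forall (a : R) X Y, D (a%:C *: X + Y) = a *: D X + D Y) ->
  D (\sum_(k < size e) (c k)%:C *: e`_k) = \sum_(k < size e) c k *: D e`_k.
Proof.
move=> DD; have D0 : D 0 = 0.
  have := DD 1 0 0; rewrite scaler0 addr0 scale1r => /eqP.
  by rewrite eq_sym -subr_eq0 addrK => /eqP.
apply: (big_ind2 (fun X y => D X = y)) => [//|X a Y b <- <-|k _].
  by have := DD 1 X Y; rewrite !scale1r.
by have := DD (c k) e`_k 0; rewrite addr0 D0 addr0.
Qed.

Lemma metric_suml_nth (e : seq M) (c : nat -> R) Z :
  metric (\sum_(k < size e) (c k)%:C *: e`_k) Z = \sum_(k < size e) c k * metric e`_k Z.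
Proof. by rewrite metric_suml; apply: eq_bigr => k _; rewrite metricZl. Qed.

Lemma orthonormal_coord g (e : seq M) X : orthonormal_basis g e -> g X ->
  X = \sum_(k < size e) (metric X e`_k)%:C *: e`_k.
Proof.
move=> [[_ on] sp] /sp [c XE]; rewrite [LHS]XE; apply: eq_bigr => k _.
congr ((_)%:C *: _); rewrite XE metric_suml_nth (bigD1 k) //= on // eqxx mulr1.
rewrite big1 ?addr0 // => j jk; rewrite on // (negPf (_ : val j != k)) ?mulr0 //.
Qed.

(** Ad-invariance of the metric: <[X,Y], X> = 0.  The integral curves of
    left-invariant fields are geodesics, so these terms do not contribute to
    the divergence. *)
Lemma koszul_skew X Y : X ^t* = - X -> koszul X Y X = 0.
Proof.
move=> Xs; have XYX : metric (bracket X Y) X = 0.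
  rewrite /metric /bracket Xs mulmxN mulmxBl -!mulmxA.
  rewrite (raddfN (@mxtrace _ n)) (raddfB (@mxtrace _ n)) /=.
  by rewrite mxtrace_mulC -mulmxA subrr oppr0.
have YX : bracket Y X = - bracket X Y by rewrite /bracket opprB.
have XX : bracket X X = 0 by rewrite /bracket subrr.
rewrite /koszul YX XX XYX /metric mulNmx (raddfN (@mxtrace _ n)) /=.
have ReN (x : R[i]) : complex.Re (- x) = - complex.Re x by case: x.
by rewrite ReN -/(metric _ _) XYX mul0mx mxtrace0 /= oppr0 subrr addr0 mulr0.
Qed.

(** Openness along the integral curves of left-invariant fields, which is all
    that derivatives along these fields can detect. *)
Definition exp_open O :=
  forall z X, O z -> \forall t \near (0 : R), O (curve z X t).

Section Real.
Variables (g O : set M) (h : M -> R) (D S : M -> M -> R).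
Hypotheses (gb : orthonormal_basis g (frame g)) (gS : real_subspace g)
  (gskew : forall X, g X -> X ^t* = - X).
Hypotheses
  (Dlin : forall z, O z -> forall (a : R) X Y, D (a%:C *: X + Y) z = a * D X z + D Y z)
  (hD : forall z X, O z -> is_derive (0 : R) (1 : R) (fun t => h (curve z X t)) (D X z))
  (DS : forall z X, O z -> is_derive (0 : R) (1 : R) (fun t => D X (curve z X t)) (S X z))
  (Oopen : exp_open O).

Lemma linv_derivE (k : M -> R) X z d :
  is_derive (0 : R) (1 : R) (fun t => k (curve z X t)) d -> linv_deriv X k z = d.
Proof. by move=> kd; rewrite /linv_deriv derive1E; exact: derive_val. Qed.

(** Linearity of X |-> D X z is what makes the gradient exist: the frame
    provides the Riesz representative. *)
Lemma gradientP z : O z ->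
  g (gradient g h z) /\ forall X, g X -> metric (gradient g h z) X = D X z.
Proof.
move=> Oz.
have hX X : linv_deriv X h z = D X z by apply: linv_derivE; exact: hD.
suff [V VP] : exists V, g V /\ forall X, g X -> metric V X = linv_deriv X h z.
  have [gG GP] := @xgetPex _ 0
    [set V | g V /\ forall X, g X -> metric V X = linv_deriv X h z]
    (ex_intro _ V VP).
  by split=> // X gX; rewrite GP.
have [[eg on] _] := gb.
exists (\sum_(k < size (frame g)) (D (frame g)`_k z)%:C *: (frame g)`_k).
split=> [|X gX]; first exact: (@real_subspace_sum g _ (fun k => D (frame g)`_k z)).
rewrite (metric_suml_nth _ (fun k => D (frame g)`_k z)) hX.
rewrite [in RHS](orthonormal_coord gb gX).
rewrite (@real_linear_sum R^o (fun X => D X z) _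
  (fun k => metric X (frame g)`_k)); last exact: Dlin.
by apply: eq_bigr => k _; rewrite metricC mulrC.
Qed.

Lemma laplacian_realE z : O z ->
  laplacian_real g h z = \sum_(X <- frame g) S X z.
Proof.
move=> Oz; rewrite /laplacian_real /divergence.
apply: eq_big_seq => X Xe; have gX : g X by exact: gb.1.1.
rewrite /covariant_deriv koszul_skew ?addr0; last exact: gskew.
apply: linv_derivE; apply: near_eq_is_derive (DS X Oz).
apply: filterS (Oopen X Oz) => t Ot.
by rewrite (gradientP Ot).2.
Qed.
End Real.

Definition along X (f : M -> R[i]) z d := cderive (fun t => f (curve z X t)) d.

(** The functions D X and S X are the first and second derivatives of f along
    X.  Carrying them as data lets sums, products and inverses be handled by
    formulas, and turns the Laplacian into a finite sum of the S X. *)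
Record twice_diff O (f : M -> R[i]) (D S : M -> M -> R[i]) : Prop := TwiceDiff {
  td_lin : forall z, O z ->
    forall (a : R) X Y, D (a%:C *: X + Y) z = a%:C * D X z + D Y z;
  td_fst : forall z X, O z -> along X f z (D X z);
  td_snd : forall z X, O z -> along X (D X) z (S X z) }.

Definition skew_algebra g := [/\ orthonormal_basis g (frame g),
  real_subspace g & forall X, g X -> X ^t* = - X].

(** The result is a formula on all of O, so that it can replace the Laplacian
    of f when this is differentiated again. *)
Lemma laplacianE g O f D S z : skew_algebra g -> exp_open O ->
  twice_diff O f D S -> O z ->
  laplacian g f z = \sum_(X <- frame g) S X z.
Proof.
move=> [gb gS gskew] Oop [Dl fD DS] Oz; rewrite /laplacian.
have ReZ (a : R) (x : R[i]) : complex.Re (a%:C * x) = a * complex.Re x.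
  by rewrite ReM /= mul0r subr0.
have ImZ (a : R) (x : R[i]) : complex.Im (a%:C * x) = a * complex.Im x.
  by rewrite ImM /= mul0r addr0.
have -> : laplacian_real g (fun w => complex.Re (f w)) z =
    \sum_(X <- frame g) complex.Re (S X z).
  apply: (@laplacian_realE g O _ (fun X z => complex.Re (D X z))
    (fun X z => complex.Re (S X z)) gb gS gskew _ _ _ Oop) => //.
  - by move=> w Ow a X Y; rewrite Dl // Re_add ReZ.
  - by move=> w X Ow; exact: (fD w X Ow).1.
  - by move=> w X Ow; exact: (DS w X Ow).1.
have -> : laplacian_real g (fun w => complex.Im (f w)) z =
    \sum_(X <- frame g) complex.Im (S X z).
  apply: (@laplacian_realE g O _ (fun X z => complex.Im (D X z))
    (fun X z => complex.Im (S X z)) gb gS gskew _ _ _ Oop) => //.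
  - by move=> w Ow a X Y; rewrite Dl // ImD ImZ.
  - by move=> w X Ow; exact: (fD w X Ow).2.
  - by move=> w X Ow; exact: (DS w X Ow).2.
rewrite -(big_morph _ (@Re_add R) (erefl : complex.Re 0 = 0)).
rewrite -(big_morph _ (@ImD R) (erefl : complex.Im 0 = 0)).
by case: (\sum_(_ <- _) _).
Qed.

Lemma twice_diff_eq O f h D S : exp_open O -> (forall z, O z -> f z = h z) ->
  twice_diff O f D S -> twice_diff O h D S.
Proof.
move=> Oop fh [Dl fD DS]; split=> // z X Oz.
apply: cderive_near (fD z X Oz); apply: filterS (Oop z X Oz) => t.
exact: fh.
Qed.

Lemma twice_diff_cst O (c : R[i]) :
  twice_diff O (fun=> c) (fun _ _ => 0) (fun _ _ => 0).
Proof.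
by split=> [z _ a X Y|z X _|z X _]; [rewrite mulr0 addr0|exact: cderive_cst..].
Qed.

Lemma twice_diffD O f1 D1 S1 f2 D2 S2 :
  twice_diff O f1 D1 S1 -> twice_diff O f2 D2 S2 ->
  twice_diff O (fun z => f1 z + f2 z) (fun X z => D1 X z + D2 X z)
    (fun X z => S1 X z + S2 X z).
Proof.
move=> [l1 d1 s1] [l2 d2 s2]; split=> [z Oz a X Y|z X Oz|z X Oz].
- by rewrite l1 // l2 // mulrDr addrACA.
- exact: cderiveD (d1 z X Oz) (d2 z X Oz).
- exact: cderiveD (s1 z X Oz) (s2 z X Oz).
Qed.

Lemma twice_diffM O f1 D1 S1 f2 D2 S2 :
  twice_diff O f1 D1 S1 -> twice_diff O f2 D2 S2 ->
  twice_diff O (fun z => f1 z * f2 z)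
    (fun X z => D1 X z * f2 z + f1 z * D2 X z)
    (fun X z => S1 X z * f2 z + (D1 X z * D2 X z) *+ 2 + f1 z * S2 X z).
Proof.
move=> [l1 d1 s1] [l2 d2 s2]; split=> [z Oz a X Y|z X Oz|z X Oz].
- by rewrite l1 // l2 //; ring.
- by have := cderiveM (d1 z X Oz) (d2 z X Oz); rewrite curve0.
- have := cderiveD (cderiveM (s1 z X Oz) (d2 z X Oz)) (cderiveM (d1 z X Oz) (s2 z X Oz)).
  by rewrite !curve0 addrA -(addrA (_ * _)) -mulr2n.
Qed.

Lemma twice_diffV O f D S : (forall z, O z -> f z != 0) ->
  twice_diff O f D S ->
  twice_diff O (fun z => (f z)^-1) (fun X z => - D X z / f z ^+ 2)
    (fun X z => (D X z ^+ 2 / f z ^+ 3) *+ 2 - S X z / f z ^+ 2).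
Proof.
move=> f0 [l d s]; split=> [z Oz a X Y|z X Oz|z X Oz].
- by rewrite l //; ring.
- have := cderiveV (d z X Oz); rewrite curve0; apply; exact: f0.
- have dz := d z X Oz; have nz := f0 z Oz.
  have V1 := cderiveV dz; rewrite curve0 in V1; have {}V1 := V1 nz.
  have V2 := cderiveM V1 V1.
  have V3 := cderiveM (cderiveM (cderive_cst (-1)) (s z X Oz)) V2.
  rewrite !curve0 in V3.
  rewrite /along.
  have -> : (fun t => - D X (curve z X t) / f (curve z X t) ^+ 2) =
      (fun t => (-1) * D X (curve z X t) *
        ((f (curve z X t))^-1 * (f (curve z X t))^-1)).
    by apply/funext => t; rewrite mulN1r expr2 invfM.
  suff -> : (D X z ^+ 2 / f z ^+ 3) *+ 2 - S X z / f z ^+ 2 =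
       (0 * D X z + -1 * S X z) * ((f z)^-1 * (f z)^-1) +
       -1 * D X z *
       (- D X z / f z ^+ 2 * (f z)^-1 + (f z)^-1 * (- D X z / f z ^+ 2)) by [].
  by field.
Qed.

(** The place where the matrix exponential enters: exp(tX) = I + tX + o(t). *)
Lemma along_entry z X i j : along X (fun w => w i j) z ((z *m X) i j).
Proof.
rewrite /along /curve mxE; under eq_fun do rewrite mxE.
apply: cderive_sum => k.
have H : cderive (fun t => expmx (t%:C *: X) k j) (X k j).
  under eq_fun do rewrite expmxE.
  have c1 : X k j = re_coeff X k j 1 +i* im_coeff X k j 1.
    by rewrite /re_coeff /im_coeff expr1 !divr1; case: (X k j).
  rewrite c1; split => /=.
    exact: exp_bounded_derive0 ler01 (entry_norm_ge0 X) (re_coeff_bounded X k j).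
  exact: exp_bounded_derive0 ler01 (entry_norm_ge0 X) (im_coeff_bounded X k j).
by have := cderiveM (cderive_cst (z i k)) H; rewrite mul0r add0r.
Qed.

Definition colform (a : 'rV[R[i]]_n) (j : 'I_n) z : R[i] := (a *m z) 0 j.

Lemma along_colform a j X z :
  along X (colform a j) z (colform a j (z *m X)).
Proof.
rewrite /along /colform mxE; under eq_fun do rewrite mxE.
apply: cderive_sum => k.
by have := cderiveM (cderive_cst (a 0 k)) (along_entry z X k j); rewrite mul0r add0r.
Qed.

Lemma twice_diff_colform O a j : twice_diff O (colform a j)
  (fun X z => colform a j (z *m X)) (fun X z => colform a j (z *m X *m X)).
Proof.
split=> [z _ r X Y|z X _|z X _].
- by rewrite /colform mulmxDr mulmxDr -!scalemxAr !mxE.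
- exact: along_colform.
- rewrite /along; have -> : (fun t => colform a j (curve z X t *m X)) =
     (fun t => \sum_k colform a k (curve z X t) * X k j).
    by apply/funext => t; rewrite /colform mulmxA mxE.
  rewrite [d in cderive _ d](_ : _ = \sum_k colform a k (z *m X) * X k j); last first.
    by rewrite /colform mulmxA mxE.
  apply: cderive_sum => k.
  have := cderiveM (along_colform a k X z) (cderive_cst (X k j)).
  by rewrite [Y in _ + Y]mulr0 [Y in cderive _ Y]addr0.
Qed.

Lemma exp_open_colform a j : exp_open [set z | colform a j z != 0].
Proof.
move=> z X /= z0; apply: cderive_neq0 (along_colform a j X z) _.
by rewrite curve0.
Qed.

End Laplacian.

(** * The Casimir identity for u(n) and su(n) *)

Section Casimir.
Variables (R : realType) (n : nat).
Local Notation M := 'M[R[i]]_n.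
Implicit Types (X Y Z z w A B : M) (g O : set M).

Definition casimir g (e : R[i]) := forall A,
  \sum_(X <- frame g) \tr (X *m A) *: X = (e * \tr A)%:M - A.

Lemma adjmxD m k (A B : 'M[R[i]]_(m, k)) : (A + B) ^t* = A ^t* + B ^t*.
Proof. by rewrite linearD map_mxD. Qed.

Lemma adjmxN m k (A : 'M[R[i]]_(m, k)) : (- A) ^t* = - A ^t*.
Proof. by rewrite linearN map_mxN. Qed.

Lemma adjmxZ m k (c : R[i]) (A : 'M[R[i]]_(m, k)) :
  (c *: A) ^t* = Num.conj c *: A ^t*.
Proof. by rewrite linearZ map_mxZ. Qed.

Lemma adjmxM A B : (A *m B) ^t* = B ^t* *m A ^t*.
Proof. by rewrite trmx_mul map_mxM. Qed.

Lemma adjmx_trace A : \tr (A ^t*) = Num.conj (\tr A).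
Proof. by rewrite trace_map_mx mxtrace_tr. Qed.

(** On skew-Hermitian matrices the complex bilinear form tr(XY) is real, and is
    minus the metric.  Expansions in a real orthonormal basis are thereby
    complex-linear identities. *)
Lemma skew_trace X Y : X ^t* = - X -> Y ^t* = - Y ->
  \tr (X *m Y) = - (metric Y X)%:C.
Proof.
move=> Xs Ys; rewrite /metric Xs mulmxN (raddfN (@mxtrace _ n)) /=.
have ReN (x : R[i]) : complex.Re (- x) = - complex.Re x by case: x.
rewrite ReN mxtrace_mulC rmorphN opprK.
have : Num.conj (\tr (Y *m X)) = \tr (Y *m X).
  by rewrite -adjmx_trace adjmxM Xs Ys mulNmx mulmxN opprK mxtrace_mulC.
case: (\tr _) => a b [] /eqP.
by rewrite -subr_eq0 -opprD oppr_eq0 -mulr2n mulrn_eq0 /= => /eqP ->.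
Qed.

Lemma skew_expansion g Y : skew_algebra g -> g Y ->
  \sum_(X <- frame g) \tr (X *m Y) *: X = - Y.
Proof.
move=> [gb gS gskew] gY; rewrite [in RHS](orthonormal_coord gb gY).
rewrite (big_nth 0) big_mkord -sumrN; apply: eq_bigr => k _.
rewrite skew_trace ?scaleNr //; apply: gskew => //.
by apply: gb.1.1; exact: mem_nth.
Qed.

(** The complexification of u(n) is the space of all matrices, and that of
    su(n) the space of matrices of trace zero. *)
Lemma skew_decomposition A : exists Y1 Y2,
  [/\ Y1 ^t* = - Y1, Y2 ^t* = - Y2, A = Y1 + 'i *: Y2 &
      \tr A = 0 -> \tr Y1 = 0 /\ \tr Y2 = 0].
Proof.
have ci : Num.conj ('i : R[i]) = - 'i.
  by rewrite -[LHS]/(0 -i* 1) -[RHS]/((- 0) +i* (- 1)) oppr0.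
have [h ch hh] : exists2 h : R[i], Num.conj h = h & h + h = 1.
  exists (2^-1 : R)%:C; first by rewrite -[LHS]/(2^-1 -i* 0) oppr0.
  by rewrite -rmorphD (_ : 2^-1 + 2^-1 = 1 :> R) //; lra.
(* h is one half, in a form on which conjugation computes. *)
exists (h *: (A - A ^t*)), (- ('i * h) *: (A + A ^t*)); split.
- by rewrite adjmxZ ch adjmxD adjmxN trmxCK -scalerN opprB addrC.
- rewrite adjmxZ (_ : Num.conj _ = 'i * h).
    by rewrite adjmxD trmxCK addrC scaleNr opprK.
  by rewrite rmorphN /= rmorphM /= ch ci mulNr opprK.
- rewrite scalerA mulrN mulrA -expr2 sqr_i mulN1r opprK -scalerDr.
  by rewrite addrACA addNr addr0 scalerDr -scalerDl hh scale1r.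
- move=> t0; rewrite !mxtraceZ !(raddfD (@mxtrace _ n)) (raddfN (@mxtrace _ n)) /=.
  by rewrite adjmx_trace t0 rmorph0 subrr addr0 !mulr0.
Qed.

Lemma u_skew_algebra : skew_algebra (@u_alg R n).
Proof.
split=> //; first exact: u_frameP.
split=> [|a X Y]; rewrite /u_alg /=.
  by apply/matrixP => j k; rewrite !mxE rmorph0 oppr0.
by move=> Xs Ys; rewrite adjoint_linear Xs Ys scalerN opprD.
Qed.

Lemma su_skew_algebra : skew_algebra (@su_alg R n).
Proof.
split=> [||X []//]; first exact: su_frameP.
split=> [|a X Y]; rewrite /su_alg /=.
  by rewrite mxtrace0; split=> //; apply/matrixP => j k; rewrite !mxE rmorph0 oppr0.
move=> [Xs Xt] [Ys Yt]; split.
  by rewrite adjoint_linear Xs Ys scalerN opprD.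
by rewrite mxtraceD mxtraceZ Xt Yt mulr0 addr0.
Qed.

Lemma expansion_linear (s : seq M) (c : R[i]) A B :
  \sum_(X <- s) \tr (X *m (A + c *: B)) *: X =
  \sum_(X <- s) \tr (X *m A) *: X + c *: \sum_(X <- s) \tr (X *m B) *: X.
Proof.
rewrite scaler_sumr -big_split /=; apply: eq_bigr => X _.
by rewrite mulmxDr mxtraceD -scalemxAr mxtraceZ scalerDl scalerA.
Qed.

Lemma u_casimir : casimir (@u_alg R n) 0.
Proof.
move=> A; have [Y1 [Y2 [s1 s2 -> _]]] := skew_decomposition A.
rewrite expansion_linear !(skew_expansion u_skew_algebra) //.
by rewrite mul0r raddf0 sub0r opprD scalerN.
Qed.

(** The scalar part of A is orthogonal to su(n), so only A - (tr A / n) I is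
    expanded. *)
Lemma su_casimir : (0 < n)%N -> casimir (@su_alg R n) n%:R^-1.
Proof.
move=> n0 A; pose c := n%:R^-1 * \tr A.
have nn0 : (n%:R : R[i]) != 0 by rewrite pnatr_eq0 -lt0n.
have AE : A = (A - c%:M) + 1 *: c%:M by rewrite scale1r subrK.
have t0 : \tr (A - c%:M) = 0.
  by rewrite (raddfB (@mxtrace _ n)) /= mxtrace_scalar -[c *+ n]mulr_natl mulVKf // subrr.
have T0 : \sum_(X <- frame (@su_alg R n)) \tr (X *m c%:M) *: X = 0.
  rewrite big_seq big1 // => X Xe.
  have [_ Xt] : @su_alg R n X by exact: (su_frameP R n).1.1.
  by rewrite mul_mx_scalar mxtraceZ Xt mulr0 scale0r.
rewrite [in LHS]AE expansion_linear T0.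
have [Y1 [Y2 [s1 s2 E /(_ t0) [t1 t2]]]] := skew_decomposition (A - c%:M).
rewrite [in LHS]E expansion_linear !(skew_expansion su_skew_algebra) //.
by rewrite scaler0 addr0 scalerN -opprD -E opprB.
Qed.

Section Contractions.
Variables (g : set M) (e : R[i]).
Hypothesis gcas : casimir g e.

(** The products of entries u X and v X contract to a single trace: (u X)_i is
    tr(XA) for the matrix A = delta_i u of rank one. *)
Lemma casimir_pair (u v : 'rV[R[i]]_n) (i j : 'I_n) :
  \sum_(X <- frame g) (u *m X) 0 i * (v *m X) 0 j =
  e * (u 0 i * v 0 j) - u 0 j * v 0 i.
Proof.
pose A : M := delta_mx i (0 : 'I_1) *m u.
have trA X : \tr (X *m A) = (u *m X) 0 i.
  by rewrite /A mulmxA mxtrace_mulC mulmxA -colE /mxtrace big_ord1 mxE.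
have vA : (v *m A) 0 j = v 0 i * u 0 j.
  by rewrite /A mulmxA -colE mxE big_ord1 mxE.
transitivity ((v *m \sum_(X <- frame g) \tr (X *m A) *: X) 0 j).
  rewrite mulmx_sumr summxE; apply: eq_bigr => X _.
  by rewrite -scalemxAr trA !mxE.
have subE (B C : 'rV[R[i]]_n) : (B - C) 0 j = B 0 j - C 0 j by rewrite !mxE.
rewrite gcas mulmxBr subE vA mul_mx_scalar mxE.
have := trA 1%:M; rewrite mul1mx mulmx1 => ->; ring.
Qed.

Lemma casimir_square (u : 'rV[R[i]]_n) (j : 'I_n) :
  \sum_(X <- frame g) (u *m X *m X) 0 j = (e - n%:R) * u 0 j.
Proof.
transitivity (\sum_k \sum_(X <- frame g) (u *m X) 0 k * (row k 1%:M *m X) 0 j).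
  rewrite exchange_big /=; apply: eq_bigr => X _; rewrite mxE.
  by apply: eq_bigr => k _; rewrite -row_mul mul1mx !mxE.
under eq_bigr do rewrite casimir_pair.
rewrite sumrB mulrBl (bigD1 j) //= !mxE eqxx mulr1 big1 ?addr0; last first.
  by move=> k kj; rewrite !mxE (negPf kj) !mulr0.
congr (_ - _); rewrite (eq_bigr (fun=> u 0 j)).
  by rewrite sumr_const card_ord mulr_natl.
by move=> k _; rewrite !mxE eqxx mulr1.
Qed.

End Contractions.
End Casimir.

(** * Quotients of linear forms in the columns *)

Section Quotient.
Variables (R : realType) (n : nat).
Local Notation M := 'M[R[i]]_n.
Implicit Types (g O : set M) (f L : M -> R[i]) (a b c p q : 'rV[R[i]]_n).

Definition has_laplacian g O f L := exists D S,
  twice_diff O f D S /\ forall z, O z -> \sum_(X <- frame g) S X z = L z.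

Lemma has_laplacianE g O f L z : skew_algebra g -> exp_open O ->
  has_laplacian g O f L -> O z -> laplacian g f z = L z.
Proof.
by move=> gs Oo [D [S [fDS SL]]] Oz; rewrite (laplacianE gs Oo fDS Oz) SL.
Qed.

Lemma has_laplacian_eq g O f h L K : exp_open O ->
  (forall z, O z -> f z = h z) -> (forall z, O z -> L z = K z) ->
  has_laplacian g O f L -> has_laplacian g O h K.
Proof.
move=> Oo fh LK [D [S [fDS SL]]]; exists D, S.
by split=> [|z Oz]; [exact: twice_diff_eq fDS|rewrite SL ?LK].
Qed.

Lemma has_laplacianZ g O (k : R[i]) f L :
  has_laplacian g O f L -> has_laplacian g O (fun z => k * f z) (fun z => k * L z).
Proof.
move=> [D [S [fDS SL]]].
do 2 eexists; split; first exact: twice_diffM (twice_diff_cst O k) fDS.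
move=> z Oz; rewrite -SL // mulr_sumr; apply: eq_bigr => X _.
by rewrite !mul0r mul0rn !add0r.
Qed.

Lemma has_laplacianD g O f L h K :
  has_laplacian g O f L -> has_laplacian g O h K ->
  has_laplacian g O (fun z => f z + h z) (fun z => L z + K z).
Proof.
move=> [D1 [S1 [t1 s1]]] [D2 [S2 [t2 s2]]].
do 2 eexists; split; first exact: twice_diffD t1 t2.
by move=> z Oz; rewrite big_split /= s1 // s2.
Qed.

Variables (g : set M) (e : R[i]).
Hypotheses (gs : skew_algebra g) (gc : casimir g e).

Lemma sum_colform_pair a i b j z :
  \sum_(X <- frame g) colform a i (z *m X) * colform b j (z *m X) =
  e * (colform a i z * colform b j z) - colform a j z * colform b i z.
Proof.
by rewrite /colform -(casimir_pair gc); apply: eq_bigr => X _; rewrite !mulmxA.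
Qed.

Lemma sum_colform_square a i z :
  \sum_(X <- frame g) colform a i (z *m X *m X) = (e - n%:R) * colform a i z.
Proof.
by rewrite /colform -(casimir_square gc); apply: eq_bigr => X _; rewrite !mulmxA.
Qed.

(** Two linear forms over the square of a third.  This family contains P/Q, as
    PQ/Q^2, as well as P'Q'/Q^2. *)
Definition ratio a i b j c k (z : M) : R[i] :=
  colform a i z * colform b j z * ((colform c k z)^-1 * (colform c k z)^-1).

(** The coefficients come from the second derivative of A B / C^2, where A, B
    and C are the three forms: 6 from the pairing of C with itself, 2 from A
    with B, -4 from A or B with C.  As 6 + 2 - 4 - 4 = 0 and 1 + 1 - 2 = 0, the
    constants e and e - n disappear. *)
Lemma has_laplacian_ratio a i b j c k :
  has_laplacian g [set z | colform c k z != 0] (ratio a i b j c k)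
  (fun z => - 6 * ratio a i b j c k z
     - 2 * ratio a j b i c k z
     + 4 * (colform b j z * colform a k z * colform c i z / colform c k z ^+ 3)
     + 4 * (colform a i z * colform b k z * colform c j z / colform c k z ^+ 3)).
Proof.
set O := [set z | _].
have tA := twice_diff_colform O a i; have tB := twice_diff_colform O b j.
have tV := @twice_diffV _ _ O _ _ _ (fun z Oz => Oz) (twice_diff_colform O c k).
do 2 eexists; split; first exact: twice_diffM (twice_diffM tA tB) (twice_diffM tV tV).
move=> z; rewrite /O /= => z0; rewrite /ratio.
set A := colform a i z; set B := colform b j z; set C := colform c k z in z0 *.
transitivity (\sum_(X <- frame g) (
   B / C ^+ 2 * colform a i (z *m X *m X)
   + A / C ^+ 2 * colform b j (z *m X *m X)
   + - 2 * A * B / C ^+ 3 * colform c k (z *m X *m X)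
   + 6 * A * B / C ^+ 4 * (colform c k (z *m X) * colform c k (z *m X))
   + 2 / C ^+ 2 * (colform a i (z *m X) * colform b j (z *m X))
   + - 4 * B / C ^+ 3 * (colform a i (z *m X) * colform c k (z *m X))
   + - 4 * A / C ^+ 3 * (colform b j (z *m X) * colform c k (z *m X)))).
  apply: eq_bigr => X _.
  by field.
rewrite !big_split -!mulr_sumr /= !sum_colform_square !sum_colform_pair -/A -/B -/C.
by field.
Qed.

Section Linear.
Variables (p q : 'rV[R[i]]_n) (al be : 'I_n).
Let O : set M := [set z | colform q be z != 0].
Let f := ratio p al q be q be.
Let F := ratio p be q al q be.

Lemma has_laplacian_quotient : has_laplacian g O f (fun z => 2 * (F z - f z)).
Proof.
apply: has_laplacian_eq (has_laplacian_ratio p al q be q be) => //.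
  exact: exp_open_colform.
by move=> z; rewrite /O /= /f /F /ratio => z0; field.
Qed.

(** The four terms of [has_laplacian_ratio] are -6f - 2F + 4F + 4f for f and
    -6F - 2f + 4F + 4F for F: both add up to 2 (F - f). *)
Lemma has_laplacian_minor : has_laplacian g O (fun z => 2 * (F z - f z)) (fun=> 0).
Proof.
have HF : has_laplacian g O F (fun z => 2 * (F z - f z)).
  apply: has_laplacian_eq (has_laplacian_ratio p be q al q be) => //.
    exact: exp_open_colform.
  by move=> z; rewrite /O /= /f /F /ratio => z0; field.
have := has_laplacianZ 2 (has_laplacianD HF (has_laplacianZ (-1) has_laplacian_quotient)).
apply: has_laplacian_eq => [|z _|z _]; first exact: exp_open_colform.
  by rewrite mulN1r.
by rewrite mulN1r subrr mulr0.
Qed.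

Lemma harmonic_iff (f0 : M -> R[i]) (W : set M) : f0 =1 f -> W `<=` O ->
  (al <> be -> exists2 z, W z & F z != f z) ->
  (harmonic_on g W f0 <-> al = be) /\ (proper_biharmonic_on g W f0 <-> al <> be).
Proof.
move=> /funext -> WO wit; have Oo := @exp_open_colform R n q be.
have lapE z : O z -> laplacian g f z = 2 * (F z - f z).
  exact: has_laplacianE has_laplacian_quotient.
have lap2E z : O z -> laplacian g (laplacian g f) z = 0.
  apply: has_laplacianE => //; apply: has_laplacian_eq has_laplacian_minor => //.
  by move=> w Ow; rewrite lapE.
have lap0 z : al = be -> O z -> laplacian g f z = 0.
  by move=> ab Oz; rewrite lapE // /F /f ab subrr mulr0.
have lapN0 : al <> be -> exists2 z, W z & laplacian g f z != 0.
  move=> /wit [z Wz Ff]; exists z => //; rewrite lapE ?mulf_neq0 ?subr_eq0 ?pnatr_eq0 //.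
  exact: WO.
split; split.
- move=> H; apply: contrapT => /lapN0 [z Wz]; rewrite H ?eqxx //.
- by move=> ab z Wz; apply: lap0 => //; exact: WO.
- by move=> [_ [z Wz]] + ab; rewrite lap0 ?eqxx //; exact: WO.
- by move=> ab; split; [move=> z Wz; apply: lap2E; exact: WO|exact: lapN0].
Qed.

End Linear.
End Quotient.

(** * A special unitary matrix at which the Laplacian does not vanish *)

Section Witness.
Variables (R : realType) (n : nat).
Local Notation M := 'M[R[i]]_n.
Local Notation V := 'rV[R[i]]_n.

Lemma conj_diag_unitary (D : V) :
  (forall i, D 0 i * Num.conj (D 0 i) = 1) -> diag_mx D \is unitarymx.
Proof.
move=> DD; apply/unitarymxP/matrixP => i j; rewrite mul_diag_mx !mxE eq_sym.
case: eqVneq => [->|_]; first by rewrite mulr1n DD.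
by rewrite mulr0n rmorph0 mulr0.
Qed.

Lemma unitary_det_norm (B : M) : B \is unitarymx -> \det B * Num.conj (\det B) = 1.
Proof.
move=> /unitarymxP /(congr1 (fun A : M => \det A)).
by rewrite det_mulmx det_map_mx det_tr det1.
Qed.

Lemma unitary_row_reindex (s : 'I_n -> 'I_n) (B : M) : injective s ->
  B \is unitarymx -> \matrix_(i, j) B (s i) j \is unitarymx.
Proof.
move=> sI /row_unitarymxP Bo; apply/row_unitarymxP => i j.
have rowE k : row k (\matrix_(i, j) B (s i) j) = row (s k) B.
  by apply/rowP => l; rewrite !mxE.
by rewrite !rowE Bo (inj_eq sI).
Qed.

Lemma two_point_injection (i0 i1 al be : 'I_n) : i0 != i1 -> al != be ->
  exists2 s : 'I_n -> 'I_n, injective s & s be = i0 /\ s al = i1.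
Proof.
move=> i01 ab; pose t := tperm be i0; exists (t * tperm (t al) i1)%g.
  exact: perm_inj.
rewrite !permM /t tpermL !tpermL; split=> //.
rewrite tpermD //; last by rewrite eq_sym.
by apply: contra ab => /eqP; rewrite -[X in _ = X](tpermL be i0) => /perm_inj ->.
Qed.

(** Gram-Schmidt on the conjugates of q and p.  Products with q^T and p^T are
    then Hermitian products with these conjugates, so that the first row sees
    q, and the second is orthogonal to q but, by independence, not to p. *)
Lemma orthonormal_pair (p q : V) (i0 i1 : 'I_n) : val i0 = 0%N -> val i1 = 1%N ->
  free [:: p; q] -> exists S : M, [/\ S \is unitarymx,
    (row i0 S *m q^T) 0 0 != 0, (row i1 S *m q^T) 0 0 = 0 &
    (row i1 S *m p^T) 0 0 != 0].
Proof.
move=> v0 v1; rewrite free_cons seq1_free span_seq1 => /andP[pq q0].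
have i01 : i0 != i1 by rewrite -val_eqE v0 v1.
pose A : M := \matrix_(i, j) if i == i0 then Num.conj (q 0 j)
                        else if i == i1 then Num.conj (p 0 j) else 0.
pose S := schmidt A.
have So : S \is unitarymx by exact: schmidt_unitarymx.
have on i j : (row i S *m (row j S) ^t*) 0 0 = (i == j)%:R.
  by rewrite -dotmxE (row_unitarymxP So).
have rowA0 : row i0 A = map_mx Num.conj q by apply/rowP => j; rewrite !mxE eqxx.
have rowA1 : row i1 A = map_mx Num.conj p.
  by apply/rowP => j; rewrite !mxE eq_sym (negPf i01) eqxx.
have conjK (v w : V) : map_mx Num.conj v = w -> v^T = w ^t*.
  move=> <-; apply/colP => j; rewrite !mxE.
  exact/esym/conjCK.
have [c qE] : exists c, map_mx Num.conj q = c *: row i0 S.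
  apply/sub_rVP; rewrite -rowA0; apply: submx_trans (row_schmidt_sub A i0) _.
  apply/sumsmx_subP => k; rewrite genmxE v0 leqn0 => /eqP k0.
  by rewrite (_ : k = i0) //; apply: val_inj; rewrite /= k0 v0.
have [x [y pE]] : exists x y, map_mx Num.conj p = x *: row i0 S + y *: row i1 S.
  have : (row i1 A <= row i0 S + row i1 S)%MS.
    apply: submx_trans (row_schmidt_sub A i1) _.
    apply/sumsmx_subP => k; rewrite genmxE v1 => k1.
    have [k0|k0] := posnP k.
      by rewrite (_ : k = i0) ?addsmxSl //; apply: val_inj; rewrite /= k0 v0.
    rewrite (_ : k = i1) ?addsmxSr //; apply: val_inj; apply/eqP.
    by rewrite v1 eqn_leq k1 k0.
  rewrite rowA1 => /sub_addsmxP [[u1 u2] /= ->].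
  by exists (u1 0 0), (u2 0 0); rewrite [u1]mx11_scalar [u2]mx11_scalar
    !mul_scalar_mx !mxE !mulr1n.
have c0 : c != 0.
  apply: contra q0 => /eqP c0; move: qE; rewrite c0 scale0r => /conjK qE.
  by apply/eqP/trmx_inj; rewrite qE !trmx0 map_mx0.
have y0 : y != 0.
  apply: contra pq => /eqP y0; apply/vlineP; exists (Num.conj (x / c)).
  apply/trmx_inj; rewrite linearZ /= (conjK _ _ qE) (conjK _ _ pE) y0 scale0r addr0.
  by rewrite !adjmxZ scalerA -rmorphM /= divfK.
exists S; rewrite (conjK _ _ qE) (conjK _ _ pE); split=> //.
- by rewrite adjmxZ -scalemxAr mxE on eqxx mulr1 conjC_eq0.
- by rewrite adjmxZ -scalemxAr mxE on eq_sym (negPf i01) mulr0.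
- rewrite adjmxD !adjmxZ mulmxDr -!scalemxAr mxE [X in X + _]mxE [X in _ + X]mxE.
  by rewrite !on [i1 == i0]eq_sym (negPf i01) eqxx mulr0 add0r mulr1 conjC_eq0.
Qed.

Lemma special_unitary_witness (p q : V) (al be : 'I_n) : free [:: p; q] ->
  al <> be -> exists z : M, [/\ z \is unitarymx, \det z = 1,
    colform q be z != 0, colform q al z = 0 & colform p al z != 0].
Proof.
move=> fpq /eqP ab.
have n1 : (1 < n)%N.
  case: n al be ab {fpq} => [[]//|[|//]] a b; by rewrite !ord1 eqxx.
pose i0 := Ordinal (ltnW n1); pose i1 := Ordinal n1.
have [S [So Sq0 Sq1 Sp1]] := @orthonormal_pair p q i0 i1 erefl erefl fpq.
have [s sI [s0 s1]] := @two_point_injection i0 i1 al be isT ab.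
pose B : M := \matrix_(i, j) S (s i) j.
have Bo : B \is unitarymx by exact: unitary_row_reindex.
have dB := unitary_det_norm Bo; set d := \det B in dB.
have d0 : d != 0.
  by apply/eqP => d0; move: dB; rewrite d0 mul0r => /eqP; rewrite eq_sym oner_eq0.
(* Dividing one row by the determinant, of modulus one, lands in SU(n) and
     rescales the forms in the corresponding column only. *)
pose D : V := \row_i if i == al then d^-1 else 1.
have Do : diag_mx D \is unitarymx.
  apply: conj_diag_unitary => i; rewrite mxE; case: ifP => _; last by rewrite rmorph1 mulr1.
  by rewrite fmorphV -invfM dB invr1.
exists (diag_mx D *m B)^T.
have colE a j : colform a j (diag_mx D *m B)^T = D 0 j * (row (s j) S *m a^T) 0 0.
  rewrite /colform -[a in LHS]trmxK -trmx_mul mxE -mulmxA mul_diag_mx mxE; congr (_ * _).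
  by rewrite !mxE; apply: eq_bigr => k _; rewrite !mxE.
have D0 j : D 0 j != 0 by rewrite mxE; case: ifP => _; rewrite ?invr_eq0 ?oner_eq0.
split.
- by rewrite trmx_unitary mul_unitarymx.
- rewrite det_tr det_mulmx det_diag (bigD1 al) //= mxE eqxx big1 ?mulr1 ?mulVf //.
  by move=> j /negPf jal; rewrite mxE jal.
- by rewrite colE s0 mulf_neq0.
- by rewrite colE s1 Sq1 mulr0.
- by rewrite colE s1 mulf_neq0.
Qed.
End Witness.

Theorem theorem4p2 (R : realType) (n : nat) (p q : 'rV[R[i]]_n)
    (alpha beta : 'I_n) (hpq : free [:: p; q]) :
  let P (z : 'M[R[i]]_n) : R[i] := \sum_(j < n) p 0 j * z j alpha in
  let Q (z : 'M[R[i]]_n) : R[i] := \sum_(k < n) q 0 k * z k beta in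
  let f (z : 'M[R[i]]_n) : R[i] := P z / Q z in
  let W := @U_group R n `&` [set z | Q z != 0] in
  [/\ harmonic_on (@u_alg R n) W f <-> alpha = beta,
      proper_biharmonic_on (@u_alg R n) W f <-> alpha <> beta,
      harmonic_on (@su_alg R n) (W `&` @SU_group R n) f <-> alpha = beta &
      proper_biharmonic_on (@su_alg R n) (W `&` @SU_group R n) f
        <-> alpha <> beta].
Proof.
move=> P Q f W.
have QE z : Q z = colform q beta z by rewrite /colform mxE.
have fE : f =1 ratio p alpha q beta q beta.
  move=> z; rewrite /f QE /ratio (_ : P z = colform p alpha z); last first.
    by rewrite /colform mxE.
  (* Where Q vanishes, both sides are 0, since the inverse of 0 is 0. *)
  have [->|Q0] := eqVneq (colform q beta z) 0; first by rewrite !invr0 !mulr0.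
  by field.
have n0 : (0 < n)%N := leq_ltn_trans (leq0n _) (ltn_ord alpha).
have wit : alpha <> beta -> exists2 z, (W `&` @SU_group R n) z &
    ratio p beta q alpha q beta z != ratio p alpha q beta q beta z.
  move=> /(special_unitary_witness hpq) [z [zU dz Q0 q0 p0]]; exists z.
    by split; split=> //=; rewrite QE.
  by rewrite /ratio q0 mulr0 mul0r eq_sym !mulf_neq0 ?invr_eq0.
have [] := @harmonic_iff R n _ _ (u_skew_algebra R n) (@u_casimir R n) p q alpha beta f W fE.
- by move=> z [_]; rewrite /= QE.
- by move=> /wit [z [Wz _] zF]; exists z.
have [] := @harmonic_iff R n _ _ (su_skew_algebra R n) (@su_casimir R n n0) p q alpha beta f
   (W `&` @SU_group R n) fE.
- by move=> z [[_ Qz] _]; move: Qz; rewrite /= QE.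
- exact: wit.
by [].
Qed.
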